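(* Let $n\ge 2$ be an integer and let $w$ be a real number with $-1<w<\frac{1}{n-1}$. Put $c:=\sqrt{(n-1)(w+1)/n}$ and $\ell:=\sqrt{(1-w(n-1))/n}$. Then the simplex $\mathcal{Q}_n(w)\subset\mathbb{R}^n$ is equidissectable with the prism $c\,\mathcal{P}_{n-1}\times I_{\ell}\subset\mathbb{R}^{n-1}\times\mathbb{R}=\mathbb{R}^n$.
   Context: For $m\ge1$ and $w>-1$ (with $w<\frac1{m-1}$ if $m\ge2$), let $v_1,\dots,v_m$ be unit vectors in $\mathbb{R}^m$ with $v_i\cdot v_j=-w$ for $i\ne j$. Then $\mathcal{Q}_m(w)$ is the simplex $\{\sum_{i=1}^m\lambda_iv_i : 1\ge\lambda_1\ge\cdots\ge\lambda_m\ge0\}$, i.e. the convex hull of $0,v_1,v_1+v_2,\dots,v_1+\cdots+v_m$; it is determined up to isometry by $m$ and $w$. Define $\mathcal{P}_m:=\mathcal{Q}_m(\frac1m)$ (in particular $\mathcal{P}_1$ is an interval of length $1$). For $c>0$, $c\,\mathcal{P}_m$ is the scaled copy $\{cx: x\in\mathcal{P}_m\}$. $I_\ell$ denotes an interval of length $\ell$. A polytope in $\mathbb{R}^n$ is a union of finitely many bounded $n$-dimensional simplices (not necessarily convex or connected). For polytopes, $P=P_1+\cdots+P_k$ means that $P=P_1\cup\cdots\cup P_k$ and the interiors of $P_1,\dots,P_k$ are pairwise disjoint. Two polytopes $P,Q\subset\mathbb{R}^n$ are equidissectable if for some $k\ge1$ there are polytopes $P_1,\dots,P_k,Q_1,\dots,Q_k$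 with $P=P_1+\cdots+P_k$, $Q=Q_1+\cdots+Q_k$ and isometries $g_1,\dots,g_k$ of $\mathbb{R}^n$ (reflections allowed) such that $g_i(P_i)=Q_i$ for all $i$. *)

(* Defs.v *)
From HB Require Import structures.
From mathcomp Require Import all_boot all_order all_algebra.
From mathcomp Require Import all_classical all_reals all_analysis.
From mathcomp Require Import ring lra.

Set Implicit Arguments.
Unset Strict Implicit.
Unset Printing Implicit Defensive.

Import Order.TTheory GRing.Theory Num.Theory.
Import numFieldNormedType.Exports.

Local Open Scope classical_set_scope.
Local Open Scope ring_scope.

Definition dot (R : realType) (n : nat) (x y : 'rV[R]_n) : R :=
  \sum_(i < n) x 0 i * y 0 i.

(* MathComp-Analysis puts the sup norm on row vectors, so the Euclidean
   distance is introduced separately; both induce the same topology, hence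
   the same interiors. *)
Definition edist (R : realType) (n : nat) (x y : 'rV[R]_n) : R :=
  Num.sqrt (dot (x - y) (x - y)).

Definition isometry (R : realType) (n : nat) (g : 'rV[R]_n -> 'rV[R]_n) : Prop :=
  forall x y, edist (g x) (g y) = edist x y.

Definition affine_independent (R : realType) (n : nat)
    (p : 'I_n.+1 -> 'rV[R]_n) : Prop :=
  row_free (\matrix_(i < n) (p (lift ord0 i) - p ord0)).

Definition conv_hull (R : realType) (n k : nat) (p : 'I_k -> 'rV[R]_n) :
    set 'rV[R]_n :=
  [set x | exists t : 'I_k -> R,
    [/\ forall i, 0 <= t i, \sum_i t i = 1 & x = \sum_i t i *: p i]].

Definition full_simplex (R : realType) (n : nat) (S : set 'rV[R]_n) : Prop :=
  exists2 p : 'I_n.+1 -> 'rV[R]_n, affine_independent p & S = conv_hull p.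

Definition polytope (R : realType) (n : nat) (P : set 'rV[R]_n) : Prop :=
  exists (k : nat) (S : 'I_k -> set 'rV[R]_n),
    (forall i, full_simplex (S i)) /\ P = \bigcup_i S i.

(* P = F_0 + ... + F_(k-1) *)
Definition dissection (R : realType) (n k : nat) (P : set 'rV[R]_n)
    (F : 'I_k -> set 'rV[R]_n) : Prop :=
  [/\ forall i, polytope (F i),
      P = \bigcup_i F i
    & forall i j, i != j -> interior (F i) `&` interior (F j) = set0].

Definition equidissectable (R : realType) (n : nat) (P Q : set 'rV[R]_n) : Prop :=
  [/\ polytope P, polytope Q
    & exists (k : nat) (F G : 'I_k -> set 'rV[R]_n)
             (g : 'I_k -> 'rV[R]_n -> 'rV[R]_n),
      [/\ (0 < k)%N, dissection P F, dissection Q G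
        & forall i, isometry (g i) /\ g i @` F i = G i]].

Definition gram_frame (R : realType) (m : nat) (w : R)
    (v : 'I_m -> 'rV[R]_m) : Prop :=
  (forall i, dot (v i) (v i) = 1) /\
  (forall i j, i != j -> dot (v i) (v j) = - w).

Definition staircase (R : realType) (m : nat) (v : 'I_m -> 'rV[R]_m) :
    set 'rV[R]_m :=
  [set x | exists lam : 'I_m -> R,
    [/\ forall i, 0 <= lam i <= 1,
        forall i j : 'I_m, (i <= j)%N -> lam j <= lam i
      & x = \sum_i lam i *: v i]].

(* Q_m(w) is determined only up to isometry: [is_Q w S] says that S is one of
   its realizations in R^m. *)
Definition is_Q (R : realType) (m : nat) (w : R) (S : set 'rV[R]_m) : Prop :=
  exists2 v : 'I_m -> 'rV[R]_m, gram_frame w v & S = staircase v.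

Definition is_P (R : realType) (m : nat) (S : set 'rV[R]_m) : Prop :=
  is_Q (m%:R^-1) S.

Definition scaled (R : realType) (n : nat) (c : R) (A : set 'rV[R]_n) :
    set 'rV[R]_n := [set c *: x | x in A].

(* A x [0, l], with R^(n-1) x R identified with R^n by appending the last
   coordinate: j is the last index, and [col' j x] drops coordinate j. *)
Definition prism (R : realType) (n : nat) (A : set 'rV[R]_n.-1) (l : R) :
    set 'rV[R]_n :=
  [set x | exists j : 'I_n,
    [/\ j = n.-1 :> nat, A (col' j x) & 0 <= x 0 j <= l]].

Lemma is_Q_exists (R : realType) (m : nat) (w : R) :
  (0 < m)%N -> -1 < w -> ((1 < m)%N -> w < (m%:R - 1)^-1) ->
  exists S : set 'rV[R]_m, is_Q w S.
Proof.
move=> m0 w1 wm.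
have mR : 0 < m%:R :> R by rewrite ltr0n.
have D0 : 0 <= 1 - (m%:R - 1) * w.
  have [m1|] := ltnP 1 m.
    have h : 0 < m%:R - 1 :> R by rewrite subr_gt0 ltr1n.
    by rewrite subr_ge0 -ler_pdivlMl // mulr1 ltW // wm.
  by case: (m) m0 => [|[|k]] // _ _; rewrite subrr mul0r subr0.
pose a := Num.sqrt (1 + w); pose s := Num.sqrt (1 - (m%:R - 1) * w).
pose b := (s - a) / m%:R.
have a2 : a ^+ 2 = 1 + w by rewrite sqr_sqrtr //; lra.
have s2 : s ^+ 2 = 1 - (m%:R - 1) * w by rewrite sqr_sqrtr.
have key : 2 * a * b + m%:R * b ^+ 2 = - w.
  have -> : 2 * a * b + m%:R * b ^+ 2 = (s ^+ 2 - a ^+ 2) / m%:R.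
    by rewrite /b; field; rewrite gt_eqF.
  by rewrite a2 s2; field; rewrite gt_eqF.
pose v (i : 'I_m) : 'rV[R]_m := \row_j (a * (j == i)%:R + b).
have dotE i j : dot (v i) (v j) = a ^+ 2 * (i == j)%:R - w.
  rewrite /dot -key.
  transitivity (\sum_(k < m) ((k == i)%:R * (a ^+ 2 * (i == j)%:R + a * b) +
                 ((k == j)%:R * (a * b) + b ^+ 2))).
    apply: eq_bigr => k _; rewrite !mxE.
    case: (eqVneq k i) => [->|_] /=; move: ((_ == j)%:R : R) => d; ring.
  rewrite !big_split /= sumr_const card_ord -!mulr_suml.
  have sum1 (l : 'I_m) : \sum_(k < m) (k == l)%:R = 1 :> R.
    by rewrite (bigD1 l) //= eqxx big1 ?addr0 // => k /negPf ->.
  rewrite !sum1 -[b ^+ 2 *+ m]mulr_natl; move: ((i == j)%:R : R) => d; ring.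
exists (staircase v), v => //; split=> [i|i j /negPf ij]; rewrite dotE.
  by rewrite eqxx mulr1 a2 addrK.
by rewrite ij mulr0 sub0r.
Qed.

(* Main.v *)
Require Import Defs.
From HB Require Import structures.
From mathcomp Require Import all_boot all_order all_algebra.
From mathcomp Require Import all_classical all_reals all_analysis.
From mathcomp Require Import ring lra zify.
Import Order.TTheory GRing.Theory Num.Theory.
Import numFieldNormedType.Exports.
Local Open Scope ring_scope.

Set Implicit Arguments.
Unset Strict Implicit.
Unset Printing Implicit Defensive.

Local Open Scope classical_set_scope.

(* Write a point as x_1 v_1 + ... + x_n v_n and continue its coordinates by
   x_(i+n) = x_i - 1. The points with nonincreasing continued coordinates form
   an infinite tube with direction v_1 + ... + v_n and cross-section c P_(n-1);
   all the v_i have height l along this direction, so the height of a point is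
   l (x_1 + ... + x_n). The shift x_i |-> x_(i+1) is a screw motion of the tube
   which lowers the height by l. The prism is the part 0 <= x_1 + ... + x_n <= 1
   of the tube, and Q_n(w) is the part x_n >= 0 >= x_(n+1): both are fundamental
   domains of the screw motion. Hence the k-th power of the shift carries the
   slab k <= x_1 + ... + x_n <= k + 1 of Q_n(w) into the prism, for 0 <= k < n,
   and these images tile the prism.

   The slabs are polytopes because a simplex can be subdivided along a
   hyperplane by repeatedly cutting an edge that crosses it. *)

(** * Simplices and affine maps *)

Section AffineGeometry.
Context {R : realType} {n : nat}.
Implicit Types (x y z : 'rV[R]_n) (A B S : set 'rV[R]_n).

Lemma dot_suml k (t : 'I_k -> R) (p : 'I_k -> 'rV[R]_n) y :
  dot (\sum_i t i *: p i) y = \sum_i t i * dot (p i) y.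
Proof.
rewrite /dot.
under [RHS]eq_bigr do rewrite mulr_sumr.
rewrite exchange_big; apply: eq_bigr => j _.
rewrite summxE mulr_suml; apply: eq_bigr => i _.
by rewrite mxE mulrA.
Qed.

Lemma dotDl x y z : dot (x + y) z = dot x z + dot y z.
Proof. by rewrite -big_split; apply: eq_bigr => i _; rewrite mxE mulrDl. Qed.

Lemma dotZl (t : R) x y : dot (t *: x) y = t * dot x y.
Proof. by rewrite mulr_sumr; apply: eq_bigr => i _; rewrite mxE mulrA. Qed.

(** Unlike [affine_independent], this form singles out no vertex, which suits moving an arbitrary
    vertex. *)
Definition affinely_free k (p : 'I_k -> 'rV[R]_n) :=
  forall t : 'I_k -> R,
    \sum_i t i = 0 -> \sum_i t i *: p i = 0 -> forall i, t i = 0.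

Lemma affine_independentP (p : 'I_n.+1 -> 'rV[R]_n) :
  affine_independent p <-> affinely_free p.
Proof.
have shiftE (t : 'I_n.+1 -> R) : \sum_i t i = 0 ->
    \sum_i t i *: p i =
    (\row_i t (lift ord0 i)) *m (\matrix_(i < n) (p (lift ord0 i) - p ord0)).
  move=> t0.
  rewrite mulmx_sum_row.
  under [RHS]eq_bigr do rewrite rowK mxE scalerBr.
  rewrite sumrB -scaler_suml [LHS]big_ord_recl /= addrC.
  congr (_ + _); move: t0; rewrite big_ord_recl => /eqP.
  by rewrite addr_eq0 => /eqP ->; rewrite scaleNr.
split=> [free t t0 tp i|free].
  have /row_freeP[B AB] := free.
  have z0 : \row_i t (lift ord0 i) = 0.
    by rewrite -[LHS]mulmx1 -AB mulmxA -shiftE // tp mul0mx.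
  have tl j : t (lift ord0 j) = 0.
    by have := congr1 (fun r : 'rV[R]_n => r 0 j) z0; rewrite !mxE.
  case: (unliftP ord0 i) => [j ->|->] //.
  by move: t0; rewrite big_ord_recl big1 ?addr0 // => j _; rewrite tl.
apply: inj_row_free => r rA.
pose t i := if unlift ord0 i is Some j then r 0 j else - \sum_j r 0 j.
have tl j : t (lift ord0 j) = r 0 j by rewrite /t liftK.
have t0 : \sum_i t i = 0.
  rewrite big_ord_recl {1}/t unlift_none.
  by under [X in _ + X]eq_bigr do rewrite tl; rewrite addNr.
have rE : \row_i t (lift ord0 i) = r by apply/rowP => j; rewrite mxE tl.
have tp : \sum_i t i *: p i = 0 by rewrite shiftE // rE.
by apply/rowP => j; rewrite -tl mxE; apply: free.
Qed.

Definition affine_fun k (f : 'rV[R]_n -> 'rV[R]_k) :=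
  forall j (t : 'I_j -> R) (p : 'I_j -> 'rV[R]_n),
    \sum_i t i = 1 -> f (\sum_i t i *: p i) = \sum_i t i *: f (p i).

Lemma image_conv_hull k j (f : 'rV[R]_n -> 'rV[R]_k) (p : 'I_j -> 'rV[R]_n) :
  affine_fun f -> f @` conv_hull p = conv_hull (f \o p).
Proof.
move=> af; apply/seteqP; split=> [_ [x [t [t0 t1 ->]] <-]|x [t [t0 t1 ->]]].
  by exists t; split=> //; rewrite af.
by exists (\sum_i t i *: p i); [exists t|rewrite af].
Qed.

(** A relation among the images has weights of sum zero. Adding weight 1 at the first vertex makes
    it an affine combination, so [f] applies and injectivity pulls the relation back to [p]. *)
Lemma full_simplex_image (f : 'rV[R]_n -> 'rV[R]_n) S :
  affine_fun f -> injective f -> full_simplex S -> full_simplex (f @` S).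
Proof.
move=> af injf [p pfree ->]; exists (f \o p); last exact: image_conv_hull.
apply/affine_independentP => t t0 tp.
move/affine_independentP : pfree; apply => //.
have d1 : \sum_(i < n.+1) (i == ord0)%:R = 1 :> R.
  by rewrite (bigD1 ord0) //= big1 ?addr0 // => i /negPf ->.
have dp (q : 'I_n.+1 -> 'rV[R]_n) : \sum_i ((i == ord0)%:R + t i) *: q i =
    q ord0 + \sum_i t i *: q i.
  under eq_bigr do rewrite scalerDl.
  rewrite big_split /= (bigD1 ord0) //= scale1r big1 ?addr0 // => i /negPf ->.
  by rewrite scale0r.
have := af _ (fun i => (i == ord0)%:R + t i) p.
rewrite big_split /= t0 d1 addr0 => /(_ erefl).
rewrite !dp [X in f (p ord0) + X]tp addr0 => /injf.
by move=> /(congr1 (+%R (- p ord0))); rewrite addKr addNr.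
Qed.

(** By affine freeness the matrix with rows [(1, p i)] is invertible; the barycentric coordinates of
    [x] are [(1, x)] times its inverse, hence affine in [x]. *)
Lemma affine_barycentric (p : 'I_n.+1 -> 'rV[R]_n) : affinely_free p ->
  exists b : 'rV[R]_n -> 'I_n.+1 -> R,
    (forall x, conv_hull p x <-> forall i, 0 <= b x i) /\
    (forall x z t i, b (x + t *: (z - x)) i = b x i + t * (b z i - b x i)).
Proof.
move=> pfree.
pose E : 'M[R]_n.+1 := row_mx (const_mx 1 : 'cV_n.+1) (\matrix_i p i).
have mulE (r : 'rV[R]_n.+1) : r *m E =
    row_mx (\sum_i r 0 i)%:M (\sum_i r 0 i *: p i) :> 'rV_(1 + n).
  transitivity (row_mx (r *m const_mx 1) (r *m \matrix_i p i) : 'rV_(1 + n)).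
    exact: mul_mx_row.
  congr row_mx.
    apply/rowP => k; rewrite !mxE ord1.
    by apply: eq_bigr => i _; rewrite mxE mulr1.
  by rewrite mulmx_sum_row; apply: eq_bigr => i _; rewrite rowK.
have Eunit : E \in unitmx.
  rewrite -row_free_unit; apply: inj_row_free => r rE.
  have : row_mx 0 0 = row_mx (\sum_i r 0 i)%:M (\sum_i r 0 i *: p i)
      :> 'rV_(1 + n) by rewrite row_mx0 -mulE.
  move=> /eq_row_mx[/esym r0 /esym rp].
  apply/rowP => i; rewrite [RHS]mxE; apply: (pfree (fun i => r 0 i)) => //.
  by have /rowP/(_ ord0) := r0; rewrite !mxE eqxx mulr1n.
pose b x := (row_mx (1 : 'rV_1) x : 'rV_(1 + n)) *m invmx E.
exists (fun x i => b x 0 i); split=> [x|x z t i].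
  split=> [[t [t0 t1 ->]] i|b0].
    suff -> : b (\sum_i t i *: p i) = \row_i t i by rewrite mxE.
    rewrite /b -[RHS](mulmxK Eunit) mulE.
    have rE j : (\row_i t i) 0 j = t j by rewrite mxE.
    rewrite (eq_bigr _ (fun j _ => rE j)) t1; congr (row_mx _ _ *m _).
    by apply: eq_bigr => j _; rewrite rE.
  have := mulE (b x); rewrite /b mulmxKV // => /eq_row_mx[/rowP/(_ ord0) b1 bp].
  exists (fun i => b x 0 i); split=> //.
  by move: b1; rewrite mxE [RHS]mxE eqxx !mulr1n => <-.
rewrite /b.
have -> : (row_mx 1 (x + t *: (z - x)) : 'rV[R]_(1 + n)) =
    row_mx 1 x + t *: (row_mx 1 z - row_mx 1 x).
  by rewrite opp_row_mx add_row_mx scale_row_mx add_row_mx subrr scaler0 addr0.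
by rewrite mulmxDl -scalemxAl mulmxBl !mxE.
Qed.

(* An elementary substitute for the closedness of simplices. *)
Lemma full_simplex_escape S x z : full_simplex S -> ~ S x ->
  exists2 e : R, 0 < e & forall t, 0 < t < e -> ~ S (x + t *: (z - x)).
Proof.
case=> p /affine_independentP /affine_barycentric[b [bP baff]] -> /bP.
move=> /existsNP[i /negP]; rewrite -ltNge => bx.
pose d := `|b z i - b x i| + 1.
have d0 : 0 < d by rewrite ltr_wpDl.
exists (- b x i / d); first by rewrite divr_gt0 // oppr_gt0.
move=> t /andP[t0 te] /bP /(_ i); rewrite baff; apply/negP; rewrite -ltNge.
move: te; rewrite ltr_pdivlMr // => te.
have : t * (b z i - b x i) <= t * d.
  by rewrite ler_pM2l // /d (le_trans (ler_norm _)) // lerDl.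
lra.
Qed.

Lemma conv_hull_convex k (p : 'I_k -> 'rV[R]_n) x z (t : R) :
  0 <= t <= 1 -> conv_hull p x -> conv_hull p z ->
  conv_hull p (x + t *: (z - x)).
Proof.
move=> /andP[t0 t1] [a [a0 a1 ->]] [b [b0 b1 ->]].
exists (fun i => a i + t * (b i - a i)); split.
- move=> i; have := a0 i; have := b0 i; nra.
- by rewrite big_split /= -mulr_sumr sumrB a1 b1 subrr mulr0 addr0.
- rewrite -sumrB scaler_sumr -big_split; apply: eq_bigr => i _ /=.
  by rewrite scalerDl -scalerBl scalerA.
Qed.

End AffineGeometry.

(** * Cutting simplices by hyperplanes *)

Section Tilings.
Context {R : realType} {n : nat}.
Implicit Types (x y z a : 'rV[R]_n) (A B S : set 'rV[R]_n).
Implicit Types (C D : set 'rV[R]_n -> Prop) (b s : R).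

(** The simplices may overlap, since a polytope is merely a finite union of them; [C] records what
    each piece has gained from the cuts. *)
Definition tiled C A := exists (k : nat) (S : 'I_k -> set 'rV[R]_n),
  (forall i, full_simplex (S i) /\ C (S i)) /\ A = \bigcup_i S i.

Lemma tiled_polytope C A : tiled C A -> polytope A.
Proof. by case=> k [S [SC ->]]; exists k, S; split=> // i; case: (SC i). Qed.

Lemma tiled_bigcup_simplex C (I : finType) (S : I -> set 'rV[R]_n) :
  (forall i, full_simplex (S i) /\ C (S i)) -> tiled C (\bigcup_i S i).
Proof.
move=> SC; exists #|I|, (S \o enum_val); split=> [i|]; first exact: SC.
apply/seteqP; split=> [x [i _ Sx]|x [i _ Sx]]; last by exists (enum_val i).
by exists (enum_rank i) => //=; rewrite enum_rankK.
Qed.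

Lemma tiled_simplex C S : full_simplex S -> C S -> tiled C S.
Proof.
move=> Sf CS; have -> : S = \bigcup_(i : unit) S.
  by rewrite bigcup_const //; exists tt.
exact: tiled_bigcup_simplex.
Qed.

Lemma tiled_bigcup C (I : finType) (A : I -> set 'rV[R]_n) :
  (forall i, tiled C (A i)) -> tiled C (\bigcup_i A i).
Proof.
move=> At.
have /choice[f fP] : forall i, exists g : {k : nat & 'I_k -> set 'rV[R]_n},
    (forall j, full_simplex (projT2 g j) /\ C (projT2 g j)) /\
    A i = \bigcup_j projT2 g j.
  by move=> i; have [k [S SP]] := At i; exists (existT _ k S).
have -> : \bigcup_i A i =
    \bigcup_(u : {i : I & 'I_(projT1 (f i))}) projT2 (f (tag u)) (tagged u).
  apply/seteqP; split=> [x [i _]|x [[i j] _ xij]].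
    by rewrite (fP i).2 => -[j _ xj]; exists (Tagged (fun i => 'I_(projT1 (f i))) j).
  by exists i => //; rewrite (fP i).2; exists j.
by apply: tiled_bigcup_simplex => -[i j]; apply: (fP i).1.
Qed.

Lemma tiled_refine C D A : tiled C A ->
  (forall S, full_simplex S -> C S -> tiled D S) -> tiled D A.
Proof.
case=> k [S [SC ->]] CD; apply: tiled_bigcup => i.
by case: (SC i); apply: CD.
Qed.

Lemma polytope_bigcup (I : finType) (A : I -> set 'rV[R]_n) :
  (forall i, polytope (A i)) -> polytope (\bigcup_i A i).
Proof.
move=> Ap; apply: (@tiled_polytope (fun=> True)); apply: tiled_bigcup => i.
by have [k [S [Sf ->]]] := Ap i; exists k, S.
Qed.

Lemma polytope_image (f : 'rV[R]_n -> 'rV[R]_n) A :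
  affine_fun f -> injective f -> polytope A -> polytope (f @` A).
Proof.
move=> af injf [k [S [Sf ->]]]; exists k, (fun i => f @` S i); split.
  by move=> i; apply: full_simplex_image.
exact: image_bigcup.
Qed.

(** Sliding [i] towards [j] by [s], or [j] towards [i] by [1 - s], reaches the same point of the
    edge; these are the two halves of a cut simplex. *)
Definition slide_vertex k (p : 'I_k -> 'rV[R]_n) (i j : 'I_k) s (m : 'I_k) :=
  p m + (m == i)%:R *: (s *: (p j - p i)).

(** In terms of weights, the slide hands the share [s] of the weight of vertex [i] to vertex [j]. *)
Lemma sum_slide_vertex k (p : 'I_k -> 'rV[R]_n) i j s (t : 'I_k -> R) :
  \sum_m t m *: slide_vertex p i j s m =
  \sum_m (t m + s * t i * ((m == j)%:R - (m == i)%:R)) *: p m.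
Proof.
have pick1 l (F : 'I_k -> 'rV[R]_n) : \sum_m (m == l)%:R *: F m = F l.
  rewrite (bigD1 l) //= eqxx scale1r big1 ?addr0 // => m /negPf ->.
  by rewrite scale0r.
under eq_bigr do rewrite scalerDr scalerA mulrC -scalerA.
under [RHS]eq_bigr do rewrite scalerDl -scalerA scalerBl.
rewrite !big_split /= pick1 -scaler_sumr sumrB !pick1 scalerA.
by rewrite [t i * s]mulrC.
Qed.

Lemma sum_slide_coef k (i j : 'I_k) s (t : 'I_k -> R) :
  \sum_m (t m + s * ((m == j)%:R - (m == i)%:R)) = \sum_m t m.
Proof.
have pick1 (l : 'I_k) : \sum_m (m == l)%:R = 1 :> R.
  by rewrite (bigD1 l) //= eqxx big1 ?addr0 // => m /negPf ->.
by rewrite big_split /= -mulr_sumr sumrB !pick1 subrr mulr0 addr0.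
Qed.

Lemma affinely_free_slide k (p : 'I_k -> 'rV[R]_n) i j s : i != j -> s != 1 ->
  affinely_free p -> affinely_free (slide_vertex p i j s).
Proof.
move=> ij s1 pfree t t0; rewrite sum_slide_vertex => tp.
have := pfree (fun m => t m + s * t i * ((m == j)%:R - (m == i)%:R)).
rewrite sum_slide_coef => /(_ t0 tp) t'0.
have ti0 : t i = 0.
  have := t'0 i; rewrite (negPf ij) eqxx => /eqP.
  rewrite (_ : _ + _ = t i * (1 - s)) /=; last by ring.
  by rewrite mulf_eq0 subr_eq0 [1 == s]eq_sym (negPf s1) orbF => /eqP.
by move=> m; have := t'0 m; rewrite ti0 mulr0 mul0r addr0.
Qed.

Lemma conv_hull_slide_sub k (p : 'I_k -> 'rV[R]_n) i j s : i != j ->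
  0 <= s <= 1 -> conv_hull (slide_vertex p i j s) `<=` conv_hull p.
Proof.
move=> ij /andP[s0 s1] _ [t [t0 t1 ->]]; rewrite sum_slide_vertex.
exists (fun m => t m + s * t i * ((m == j)%:R - (m == i)%:R)); split=> //.
  move=> m; have [->|_] := eqVneq m j; have [->|_] := eqVneq _ i => /=.
  - by rewrite subrr mulr0 addr0.
  - by rewrite subr0 mulr1 addr_ge0 // mulr_ge0.
  - have := t0 i; nra.
  - by rewrite subrr mulr0 addr0.
by rewrite sum_slide_coef.
Qed.

Lemma conv_hull_slide_half k (p : 'I_k -> 'rV[R]_n) i j s (t : 'I_k -> R) :
  i != j -> s < 1 -> (forall m, 0 <= t m) -> \sum_m t m = 1 ->
  s * t i <= (1 - s) * t j ->
  conv_hull (slide_vertex p i j s) (\sum_m t m *: p m).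
Proof.
move=> ij s1 t0 t1 tij; have s1' : 0 < 1 - s by rewrite subr_gt0.
(* The new weights [t'] invert the transfer of [sum_slide_vertex]; the hypothesis on [t i] and [t j]
   says precisely that [t' j] is nonnegative. *)
pose r := s / (1 - s).
pose t' m := t m + r * t i * ((m == i)%:R - (m == j)%:R).
have t'i : t' i = t i / (1 - s).
  by rewrite /t' eqxx (negPf ij) /r /= subr0 mulr1; field; rewrite gt_eqF.
exists t'; split.
- move=> m; rewrite /t'; have [->|_] := eqVneq m i.
    by rewrite -/(t' i); move: t'i; rewrite /t' eqxx => ->; rewrite divr_ge0 // ltW.
  have [->|_] := eqVneq m j; last by rewrite subrr mulr0 addr0.
  rewrite /= sub0r mulrN1 subr_ge0 /r mulrAC ler_pdivrMr // mulrC //.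
  by rewrite [t j * _]mulrC mulrC.
- by rewrite /t' sum_slide_coef.
- rewrite sum_slide_vertex; apply: eq_bigr => m _; congr (_ *: _).
  by rewrite t'i /t' /r; ring.
Qed.

Lemma conv_hull_slideU k (p : 'I_k -> 'rV[R]_n) i j s : i != j ->
  0 < s < 1 -> conv_hull p =
  conv_hull (slide_vertex p i j s) `|` conv_hull (slide_vertex p j i (1 - s)).
Proof.
move=> ij /andP[s0 s1]; apply/seteqP; split=> x; last first.
  case; apply: conv_hull_slide_sub => //; [|by rewrite eq_sym|]; lra.
case=> t [t0 t1 ->].
case: (leP (s * t i) ((1 - s) * t j)) => [tij|/ltW tij]; [left|right].
  exact: conv_hull_slide_half.
apply: conv_hull_slide_half => //; first by rewrite eq_sym.
  lra.
by rewrite opprB addrCA subrr addr0.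
Qed.

Definition one_sided a b S :=
  (forall x, S x -> dot x a <= b) \/ (forall x, S x -> b <= dot x a).

Lemma sum_weight_le k (t : 'I_k -> R) (c : 'I_k -> R) b :
  (forall i, 0 <= t i) -> \sum_i t i = 1 -> (forall i, c i <= b) ->
  \sum_i t i * c i <= b.
Proof.
move=> t0 t1 cb; rewrite -[leRHS]mul1r -t1 mulr_suml.
by apply: ler_sum => i _; rewrite ler_wpM2l.
Qed.

Lemma sum_weight_ge k (t : 'I_k -> R) (c : 'I_k -> R) b :
  (forall i, 0 <= t i) -> \sum_i t i = 1 -> (forall i, b <= c i) ->
  b <= \sum_i t i * c i.
Proof.
move=> t0 t1 cb; rewrite -[leLHS]mul1r -t1 mulr_suml.
by apply: ler_sum => i _; rewrite ler_wpM2l.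
Qed.

(* An edge whose endpoints lie strictly on opposite sides of the hyperplane is
   split at its intersection with it; each half has fewer vertices off the
   hyperplane. *)
Lemma full_simplex_cut a b S : full_simplex S -> tiled (one_sided a b) S.
Proof.
case=> p pf ->.
move: {2}#|_| (leqnn #|[pred m | dot (p m) a != b]|) pf => N.
elim: N p => [|N IH] p pN pf.
all: have Sf : full_simplex (conv_hull p) by exists p.
  apply: tiled_simplex => //; left=> _ [t [t0 t1 ->]].
  rewrite dot_suml; apply: sum_weight_le => // i.
  by move: pN; rewrite leqn0 => /eqP /card0_eq /(_ i) /negbFE /eqP ->.
have [/existsP[i pi]|/existsPn np] := boolP [exists i, dot (p i) a < b];
  last first.
  apply: tiled_simplex => //; right=> _ [t [t0 t1 ->]].
  by rewrite dot_suml; apply: sum_weight_ge => // i; rewrite leNgt np.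
have [/existsP[j pj]|/existsPn np] := boolP [exists i, b < dot (p i) a];
  last first.
  apply: tiled_simplex => //; left=> _ [t [t0 t1 ->]].
  by rewrite dot_suml; apply: sum_weight_le => // l; rewrite leNgt np.
have ij : i != j by apply: contraTneq pi => ->; rewrite -leNgt ltW.
have dot_slide i' j' s m : dot (slide_vertex p i' j' s m) a =
    dot (p m) a + (m == i')%:R * (s * (dot (p j') a - dot (p i') a)).
  by rewrite /slide_vertex dotDl !dotZl dotDl -scaleN1r dotZl mulN1r.
have slideN i' j' s : dot (p i') a != b ->
    dot (p i') a + s * (dot (p j') a - dot (p i') a) = b ->
    (#|[pred m | dot (slide_vertex p i' j' s m) a != b]| <= N)%N.
  move=> pi' sE; rewrite -ltnS; apply: leq_trans pN; apply: proper_card.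
  apply/properP; split; last first.
    by exists i'; rewrite !inE //= dot_slide eqxx mul1r sE eqxx.
  apply/fintype.subsetP => m; rewrite !inE dot_slide; apply: contraNN => /eqP pm.
  have [mi|_] := eqVneq m i'; last by rewrite mul0r addr0 pm.
  by move: pi'; rewrite -mi pm eqxx.
pose s := (b - dot (p i) a) / (dot (p j) a - dot (p i) a).
have dij : 0 < dot (p j) a - dot (p i) a by lra.
have s01 : 0 < s < 1.
  apply/andP; split; first by rewrite divr_gt0 // subr_gt0.
  by rewrite /s ltr_pdivrMr // mul1r; lra.
have -> : conv_hull p = \bigcup_(e : bool)
    (if e then conv_hull (slide_vertex p i j s)
     else conv_hull (slide_vertex p j i (1 - s))).
  rewrite (@conv_hull_slideU _ _ i j s) //; apply/seteqP; split=> x.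
    by case=> xS; [exists true|exists false].
  by case=> -[] _ xS; [left|right].
have afi : affinely_free p by apply/affine_independentP.
apply: tiled_bigcup => -[]; apply: IH.
- apply: slideN; first by rewrite lt_eqF.
  by rewrite /s divfK ?gt_eqF //; lra.
- by apply/affine_independentP; apply: affinely_free_slide => //; lra.
- apply: slideN; first by rewrite gt_eqF.
  by rewrite /s; field; rewrite gt_eqF.
- apply/affine_independentP; apply: affinely_free_slide => //; last lra.
  by rewrite eq_sym.
Qed.

Lemma one_sided_sub a b S S' : S' `<=` S -> one_sided a b S -> one_sided a b S'.
Proof. by move=> sub [h|h]; [left|right] => x /sub /h. Qed.

(** Cut [S] along both hyperplanes and keep the pieces inside the slab. Suppose they miss a point
    [x] of the slab. A small move from [x] towards [z] still avoids them but enters the open slab;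
    the piece containing the new point lies on one side of each hyperplane, so it is inside the slab
    after all. *)
Lemma slab_polytope S a b b' z : full_simplex S -> S z ->
  b < dot z a < b' -> polytope (S `&` [set x | b <= dot x a <= b']).
Proof.
move=> Sf Sz /andP[bz zb'].
have [k [T [TP ST]]] : tiled (fun S => one_sided a b S /\ one_sided a b' S) S.
  apply: (tiled_refine (full_simplex_cut a b Sf)) => S1 S1f side1.
  have [k [T [TP S1T]]] := full_simplex_cut a b' S1f.
  exists k, T; split=> // i; case: (TP i) => Tf Ti; do 2!split=> //.
  by apply: one_sided_sub side1; rewrite S1T => x Tx; exists i.
pose slab : set 'rV[R]_n := [set x | b <= dot x a <= b'].
pose J := {i : 'I_k | `[< T i `<=` slab >]}.
suff -> : S `&` slab = \bigcup_(i : J) T (val i).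
  by apply: (@tiled_polytope (fun=> True)); apply: tiled_bigcup_simplex => i;
    split=> //; case: (TP (val i)).
apply/seteqP; split=> [x [Sx xslab]|x [[i ii] _ /= Tx]]; last first.
  by move/asboolP : ii => /(_ _ Tx) xs; split=> //; rewrite ST; exists i.
apply: contrapT => xJ.
have /choice[e eP] : forall i : 'I_k, exists e : R, 0 < e /\
    (T i `<=` slab -> forall t, 0 < t < e -> ~ T i (x + t *: (z - x))).
  move=> i; have [Ti|nTi] := pselect (T i `<=` slab); last by exists 1.
  have [|e e0 ePe] := full_simplex_escape (x := x) z (TP i).1.
    by move=> Tx; apply: xJ; exists (Sub i (asboolT Ti)).
  by exists e.
(* Starting the minimum at 1 keeps [t] below 1, and halving puts it strictly below every [e i]. *)
pose t := (\big[Num.min/1]_i e i) / 2.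
have m0 : 0 < \big[Num.min/1]_i e i :> R.
  by elim/big_ind: _ => // [u v u0 v0|i _]; [rewrite lt_min u0|case: (eP i)].
have m1 : \big[Num.min/1]_i e i <= 1 :> R by apply: bigmin_le_id.
have me i : t < e i.
  by have := bigmin_le 1 i e; rewrite /t; lra.
have t01 : 0 < t < 1 by rewrite /t; lra.
have : S (x + t *: (z - x)).
  case: Sf Sx Sz => p _ ->; apply: conv_hull_convex; lra.
rewrite ST => -[i _ Tt].
have dt : dot (x + t *: (z - x)) a = dot x a + t * (dot z a - dot x a).
  by rewrite dotDl dotZl dotDl -scaleN1r dotZl mulN1r.
move: xslab => /andP[bx xb'].
have dtb : b < dot (x + t *: (z - x)) a by rewrite dt; nra.
have dtb' : dot (x + t *: (z - x)) a < b' by rewrite dt; nra.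
have Tslab : T i `<=` slab.
  case: (TP i) => _ [[h|h] [h'|h']] y Ty.
  - by have := h _ Tt; rewrite leNgt dtb.
  - by have := h _ Tt; rewrite leNgt dtb.
  - by rewrite /slab /= h // h'.
  - by have := h' _ Tt; rewrite leNgt dtb'.
case: (eP i) => _ /(_ Tslab t); apply => //.
by case/andP: t01 => -> _; rewrite me.
Qed.

(** At a common interior point [f] is at least [b], while a short move along [d] stays in [A] and
    raises [f] above [b]. Continuity is needed only for the path, not for [f]. *)
Lemma interior_separated A B (f : 'rV[R]_n -> R) (d : 'rV[R]_n) b :
  (forall x t, f (x + t *: d) = f x + t) ->
  (forall x, A x -> f x <= b) -> (forall x, B x -> b <= f x) ->
  interior A `&` interior B = set0.
Proof.
move=> fd fA fB; apply/seteqP; split=> // x [Ax Bx].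
have cvg : x + t *: d @[t --> (0 : R)] --> x + 0 *: d.
  by apply: cvgD; [exact: cvg_cst|apply: cvgZr_tmp; exact: cvg_id].
rewrite scale0r addr0 in cvg.
have near0 (E : set 'rV[R]_n) : nbhs x E ->
    exists2 e : R, 0 < e & forall t, `|t| < e -> E (x + t *: d).
  move=> /cvg /nbhs_normP[e /= e0 eE]; exists e => // t te; apply: eE => /=.
  by rewrite sub0r normrN.
have xA : A x by apply: interior_subset.
have xB : B x by apply: interior_subset.
have [e e0 eA] := near0 _ Ax.
have /eA/fA : `|e / 2| < e by rewrite gtr0_norm; lra.
by rewrite fd; have := fB _ xB; lra.
Qed.

End Tilings.

(** * The screw motion in coordinates *)

Section Staircase.
Context {R : realType} {n : nat}.
Implicit Types x : 'rV[R]_n.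

Definition stairs : set 'rV[R]_n :=
  [set x | (forall i, 0 <= x 0 i <= 1) /\
           (forall i j : 'I_n, (i <= j)%N -> x 0 j <= x 0 i)].

Let tail (t : 'I_n.+1 -> R) c := \sum_(k < n.+1 | (c <= k)%N) t k.

Lemma full_simplex_stairs : full_simplex stairs.
Proof.
(* Vertex [k] has its first [k] coordinates equal to 1, so coordinate [j] of a combination is the
   tail of the weights from [j.+1] on. *)
pose p (k : 'I_n.+1) : 'rV[R]_n := \row_j (j < k)%:R.
have pE t : \sum_k t k *: p k = \row_j tail t j.+1.
  apply/rowP => j; rewrite summxE !mxE /tail [RHS]big_mkcond; apply: eq_bigr => k _.
  by rewrite !mxE; case: ltnP; rewrite (mulr1, mulr0).
have tailS t (k : 'I_n.+1) : tail t k = t k + tail t k.+1.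
  rewrite /tail (bigD1 k) //=; congr (_ + _); apply: eq_bigl => i.
  by rewrite andbC ltn_neqAle eq_sym.
exists p; first apply/affine_independentP => t t0.
  rewrite pE => tl0.
  have tail0 c : (c <= n)%N -> tail t c = 0.
    case: c => [|c] cn; first exact: t0.
    by have /rowP/(_ (Ordinal cn)) := tl0; rewrite !mxE.
  move=> k; have := tailS t k; rewrite tail0 -1?ltnS //.
  have [kn|kn] := ltnP k n; first by rewrite tail0 // addr0.
  rewrite {1}/tail big1 ?addr0 // => i ki; move: (ltn_ord i).
  by rewrite ltnNge (leq_trans _ ki).
apply/seteqP; split=> x.
  case=> x01 xle.
  (* [L] runs through 1, the coordinates of [x], and 0; its successive drops are the barycentric
     weights of [x]. *)
  pose L c := if c is c'.+1 then oapp (fun i => x 0 i) 0 (insub c') else 1.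
  have LS (i : 'I_n) : L i.+1 = x 0 i by rewrite /L valK.
  have Ln : L n.+1 = 0 by rewrite /L insubF ?ltnn.
  have tailE c : (c <= n.+1)%N ->
      tail (fun k : 'I_n.+1 => L k - L k.+1) c = L c.
    move=> cn; rewrite /tail.
    rewrite -(big_geq_mkord c n.+1 xpredT (fun k => L k - L k.+1)).
    under eq_bigr do rewrite -opprB.
    by rewrite sumrN telescope_sumr // opprB Ln subr0.
  exists (fun k : 'I_n.+1 => L k - L k.+1); split.
  - case=> -[|k] kn; rewrite subr_ge0 /=.
      by case: insubP => [i _ _|_] //=; case/andP: (x01 i).
    have kn' : (k < n)%N by [].
    rewrite [leRHS](_ : _ = x 0 (Ordinal kn')); last exact: (LS (Ordinal kn')).
    case: insubP => [i _ ik|_] /=; last by case/andP: (x01 (Ordinal kn')).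
    by apply: xle; rewrite ik /=.
  - exact: (tailE 0).
  - rewrite pE; apply/rowP => j; rewrite mxE tailE ?LS //.
    by rewrite ltnS ltnW.
case=> t [t0 t1 ->]; rewrite pE.
have tail_le c c' : (c <= c')%N -> tail t c' <= tail t c.
  move=> cc'; rewrite /tail [leLHS]big_mkcond [leRHS]big_mkcond.
  apply: ler_sum => i _; case: ifPn => [c'i|_]; last by case: ifP.
  by rewrite (leq_trans cc' c'i).
split=> [i|i j ij]; rewrite !mxE; last by apply: tail_le.
rewrite sumr_ge0 //=; have := tail_le 0 i.+1 isT.
by rewrite {2}/tail t1.
Qed.

End Staircase.

(** * Continued coordinates, the shift and its fundamental domains *)

Section Screw.
Context {R : realType} {m : nat}.
Local Notation n := m.+1.
Implicit Types (x y : 'rV[R]_n).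

(** Advancing the window by one index trades [E k] for [E (k + n)], a gain of [e]. *)
Lemma sum_quasiperiodic (E : nat -> R) e k :
  (forall i, E (i + n)%N = E i + e) ->
  \sum_(i < n) E (i + k)%N = \sum_(i < n) E i + e *+ k.
Proof.
move=> En; elim: k => [|k IH].
  by rewrite addr0; apply: eq_bigr => i _; rewrite addn0.
have h1 : \sum_(i < n.+1) E (i + k)%N = E k + \sum_(i < n) E (i + k.+1)%N.
  rewrite big_ord_recl; congr (_ + _); apply: eq_bigr => i _.
  by rewrite lift0 addSnnS.
have h2 : \sum_(i < n.+1) E (i + k)%N = \sum_(i < n) E i + e *+ k + (E k + e).
  by rewrite big_ord_recr /= IH [(n + k)%N]addnC En.
by apply: (addrI (E k)); rewrite -h1 h2 mulrSr addrCA !addrA.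
Qed.

(* The coordinates continued to all natural indices so that an index shift by
   [n] subtracts [1]. *)
Definition unroll x (i : nat) : R := x 0 (inord (i %% n)) - (i %/ n)%:R.

Lemma unroll_ord x (i : 'I_n) : unroll x i = x 0 i.
Proof. by rewrite /unroll modn_small // divn_small // subr0 inord_val. Qed.

Lemma unrollDM x i q : unroll x (i + q * n)%N = unroll x i - q%:R.
Proof.
by rewrite /unroll addnC modnMDl divnMDl // natrD opprD addrA addrAC.
Qed.

Lemma unrollDn x i : unroll x (i + n)%N = unroll x i - 1.
Proof. by rewrite -[n in LHS]mul1n unrollDM. Qed.

Definition screw k x : 'rV[R]_n := \row_i unroll x (i + k)%N.

Lemma unroll_screw k x i : unroll (screw k x) i = unroll x (i + k)%N.
Proof.
rewrite {1}/unroll mxE inordK ?ltn_mod // -unrollDM; congr unroll.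
by rewrite addnAC [(i %% n + _)%N]addnC -divn_eq.
Qed.

Lemma screw_inj k : injective (screw k).
Proof.
move=> x y xy; apply/rowP => i.
(* As [k * m + k = k * n], this further shift completes [k] whole periods and recovers coordinate
   [i] up to the constant [k]. *)
have := congr1 (fun z => unroll z (i + k * m)%N) xy.
by rewrite !unroll_screw -addnA -mulnSr !unrollDM !unroll_ord => /addIr.
Qed.

Lemma sum_screw k x : \sum_i screw k x 0 i = \sum_i x 0 i - k%:R.
Proof.
under eq_bigr do rewrite mxE.
rewrite (@sum_quasiperiodic (unroll x) (-1)); last exact: unrollDn.
by rewrite mulNrn; congr (_ - _); apply: eq_bigr => i _; rewrite unroll_ord.
Qed.

Lemma screw_diff k x y i :
  (screw k x - screw k y) 0 i = (x - y) 0 (inord ((i + k) %% n)).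
Proof. by rewrite !mxE /unroll; ring. Qed.

(** The integer corrections cancel in a difference, so the shift only permutes its coordinates
    cyclically. The square and the identity as [f] will give the isometry. *)
Lemma sum_screw_diff k x y (f : R -> R) :
  \sum_i f ((screw k x - screw k y) 0 i) = \sum_i f ((x - y) 0 i).
Proof.
under eq_bigr do rewrite screw_diff.
rewrite (@sum_quasiperiodic (fun i => f ((x - y) 0 (inord (i %% n)))) 0).
  rewrite mul0rn addr0; apply: eq_bigr => i _.
  by rewrite modn_small // inord_val.
by move=> i; rewrite modnDr addr0.
Qed.

Lemma screw_affine k : affine_fun (screw k).
Proof.
move=> j t p t1; apply/rowP => i; rewrite summxE mxE /unroll summxE.
under eq_bigr do rewrite mxE.
under [RHS]eq_bigr do rewrite !mxE mulrBr.
by rewrite sumrB -mulr_suml t1 mul1r.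
Qed.

Definition unrolled_decr x := forall i j, (i <= j)%N -> unroll x j <= unroll x i.

(** It suffices to compare consecutive indices: inside a period these are neighbouring coordinates,
    and at its end the last coordinate meets the first one minus 1. *)
Lemma unrolled_decrP x : unrolled_decr x <->
  (forall i j : 'I_n, (i <= j)%N -> x 0 j <= x 0 i) /\
  x 0 ord0 - x 0 ord_max <= 1.
Proof.
split=> [xd|[xle x1]].
  split=> [i j ij|]; first by rewrite -!unroll_ord xd.
  rewrite lerBlDr -lerBlDl -!unroll_ord -unrollDn; apply: xd.
  by rewrite add0n.
have step i : unroll x i.+1 <= unroll x i.
  rewrite (divn_eq i n) addnC -addSn !unrollDM lerD2r.
  have := ltn_pmod i (ltn0Sn m); set r := (i %% n)%N => rn.
  have [rm|rm] := ltnP r m.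
    rewrite -[r.+1]/(nat_of_ord (Ordinal (rm : (r.+1 < n)%N))).
    rewrite -[X in _ <= unroll x X]/(nat_of_ord (Ordinal rn)) !unroll_ord.
    exact: xle.
  have -> : r = m by apply/eqP; rewrite eqn_leq rm -ltnS rn.
  have := unrollDn x 0; rewrite add0n => ->.
  rewrite -[0%N]/(nat_of_ord (@ord0 m)).
  rewrite -[X in _ <= unroll x X]/(nat_of_ord (@ord_max m)).
  by rewrite !unroll_ord; lra.
move=> i j; elim: j => [|j IH]; first by rewrite leqn0 => /eqP ->.
by rewrite leq_eqVlt => /predU1P[->//|/IH]; apply: le_trans.
Qed.

Lemma screw_decr k x : unrolled_decr x -> unrolled_decr (screw k x).
Proof. by move=> xd i j ij; rewrite !unroll_screw xd // leq_add2r. Qed.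

Lemma stairsE x : stairs x <->
  [/\ unrolled_decr x, 0 <= unroll x m & unroll x n <= 0].
Proof.
have um : unroll x m = x 0 ord_max by rewrite -unroll_ord.
have un : unroll x n = x 0 ord0 - 1 by rewrite -unroll_ord -unrollDn add0n.
rewrite um un; split=> [[x01 xle]|[/unrolled_decrP[xle _] xm x0]].
  have := x01 ord0; have := x01 ord_max => /andP[a b] /andP[c d].
  by split; [apply/unrolled_decrP; split => //|..]; lra.
split=> // i; apply/andP; split.
  by apply: le_trans xm _; apply: xle; rewrite -ltnS.
by apply: le_trans (xle ord0 _ _) _ => //; rewrite -subr_le0.
Qed.

Definition stair_slab k : set 'rV[R]_n :=
  stairs `&` [set x | k%:R <= dot x (const_mx 1) <= k%:R + 1].

Lemma dot_ones x : dot x (const_mx 1) = \sum_i x 0 i.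
Proof. by apply: eq_bigr => i _; rewrite mxE mulr1. Qed.

Lemma stair_slab_polytope k : (k < n)%N -> polytope (stair_slab k).
Proof.
(* The point strictly inside the slab lies on the diagonal and has coordinate sum [k + 1/2]. *)
move=> kn; apply: (@slab_polytope _ _ _ _ _ _ (const_mx ((k%:R + 2^-1) / n%:R))).
- exact: full_simplex_stairs.
- have n0 : 0 < n%:R :> R by rewrite ltr0n.
  split=> [i|i j _]; rewrite !mxE // divr_ge0 ?addr_ge0 ?ler0n ?invr_ge0 //=.
  rewrite ler_pdivrMr // mul1r.
  have : k%:R + 1 <= n%:R :> R by rewrite natr1 ler_nat.
  lra.
- rewrite dot_ones; under eq_bigr do rewrite mxE.
  rewrite sumr_const card_ord -[_ *+ n]mulr_natr divfK ?pnatr_eq0 //.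
  lra.
Qed.

Lemma stairs_slabs : stairs = \bigcup_(k : 'I_n) stair_slab k.
Proof.
apply/seteqP; split=> [x xs|x [k _ []]] //.
have [k kn xk] : exists2 k, (k < n)%N & k%:R <= \sum_i x 0 i <= k%:R + 1.
  have : 0 <= \sum_i x 0 i <= n%:R.
    case: xs => x01 _; apply/andP; split.
      by apply: sumr_ge0 => i _; case/andP: (x01 i).
    rewrite -[n in n%:R]card_ord -sumr_const.
    by apply: ler_sum => i _; case/andP: (x01 i).
  move: (\sum_i _) => s; clear x xs; elim: m => [|j IH] /andP[s0 sj].
    by exists 0%N => //; rewrite s0 add0r.
  have [sj1|/ltW sj1] := leP s j.+1%:R.
    have [|k kj kP] := IH; first by rewrite s0.
    by exists k => //; apply: ltnW.
  by exists j.+1 => //; rewrite sj1 natr1.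
by exists (Ordinal kn) => //; split=> //=; rewrite dot_ones.
Qed.

Definition tube_slab : set 'rV[R]_n :=
  [set x | unrolled_decr x /\ 0 <= \sum_i x 0 i <= 1].

Lemma tube_slab_screw : tube_slab = \bigcup_(k : 'I_n) (screw k @` stair_slab k).
Proof.
apply/seteqP; split=> [y [yd /andP[y0 y1]]|]; last first.
  move=> _ [k _ [x [/stairsE[xd _ _] /andP[xk xk1] <-]]]; split; first exact: screw_decr.
  by move: xk xk1; rewrite dot_ones sum_screw; lra.
have yle (i : 'I_n) : unroll y m <= y 0 i <= unroll y 0.
  by rewrite -unroll_ord !yd // -ltnS.
have ex : exists k, 0 <= unroll y (m - k).
  exists m; rewrite subnn leNgt; apply/negP => neg.
  have yneg i : y 0 i < 0 by case/andP: (yle i) => _ /le_lt_trans; apply.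
  move: y0; rewrite big_ord_recl leNgt => /negP; apply.
  have : \sum_(i < m) y 0 (lift ord0 i) <= 0 by apply: sumr_le0 => i _; apply: ltW.
  by have := yneg ord0; lra.
(* Minimality of [k] locates the sign change: the continued coordinates of [y] are nonnegative up to
   index [m - k] and nonpositive from [n - k] on. *)
have [k yk kmin] := ex_minnP ex.
have km : (k <= m)%N.
  rewrite leqNgt; apply/negP => mk.
  have := kmin m; rewrite subnn; move: yk; rewrite (_ : m - k = 0)%N; last by lia.
  by move=> -> /(_ isT); lia.
have yk' : unroll y (n - k) <= 0.
  (* For [k = 0] all coordinates are nonnegative with sum at most 1, so the first is at most 1.
     Otherwise minimality applies. *)
  case: k yk kmin km => [|k] yk kmin km.
    rewrite subn0 -[n]add0n unrollDn subr_le0; apply: le_trans y1.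
    rewrite -[0%N]/(nat_of_ord (@ord0 m)) unroll_ord big_ord_recl lerDl.
    apply: sumr_ge0 => i _; move: yk; rewrite subn0 => yk.
    by apply: le_trans yk _; case/andP: (yle (lift ord0 i)).
  rewrite subSS leNgt; apply/negP => /ltW yk1.
  by have := kmin _ yk1; rewrite ltnn.
(* Shifting by [n] subtracts 1 everywhere, so shifting by [n - k] and adding 1 undoes [screw k]. *)
pose x : 'rV[R]_n := \row_i (unroll y (i + (n - k))%N + 1).
have ux i : unroll x i = unroll y (i + (n - k))%N + 1.
  rewrite {1}/unroll mxE inordK ?ltn_mod // addrAC -unrollDM; congr (unroll _ _ + _).
  by rewrite {3}(divn_eq i n); lia.
exists (Ordinal (km : (k < n)%N)) => //; exists x; last first.
  apply/rowP => i; rewrite mxE ux /= (_ : _ + _ = i + n)%N; last by lia.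
  by rewrite unrollDn unroll_ord subrK.
split.
  apply/stairsE; split; rewrite ?ux.
  - by move=> i j ij; rewrite !ux lerD2r yd // leq_add2r.
  - rewrite (_ : (m + (n - k)) = (m - k) + n)%N ?unrollDn ?subrK //; lia.
  - by rewrite addnC unrollDn subrK.
have dx : dot x (const_mx 1) = \sum_i y 0 i + k%:R.
  rewrite dot_ones; under eq_bigr do rewrite mxE.
  rewrite big_split /= sumr_const card_ord.
  rewrite (@sum_quasiperiodic (unroll y) (-1)); last exact: unrollDn.
  rewrite mulNrn natrB; last by lia.
  by rewrite (eq_bigr _ (fun i _ => unroll_ord y i)); lra.
by rewrite /= dx; lra.
Qed.

End Screw.

(** * Gram frames and the prism *)

Section Frames.
Context {R : realType} {n : nat}.
Implicit Types (x y : 'rV[R]_n) (w : R) (v : 'I_n -> 'rV[R]_n).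

Lemma dotC x y : dot x y = dot y x.
Proof. by apply: eq_bigr => i _; rewrite mulrC. Qed.

Definition frame_mx v : 'M[R]_n := \matrix_i v i.

Lemma mul_frame_mx x v : x *m frame_mx v = \sum_i x 0 i *: v i.
Proof. by rewrite mulmx_sum_row; apply: eq_bigr => i _; rewrite rowK. Qed.

Lemma staircaseE v : staircase v = (fun x => x *m frame_mx v) @` stairs.
Proof.
apply/seteqP; split=> [_ [lam [lam01 lamle ->]]|_ [x [x01 xle] <-]].
  exists (\row_i lam i); last first.
    by rewrite mul_frame_mx; apply: eq_bigr => i _; rewrite mxE.
  by split=> [i|i j ij]; rewrite !mxE ?lamle.
by exists (fun i => x 0 i); split=> //; rewrite mul_frame_mx.
Qed.

Lemma gram_frameP w v :
  gram_frame w v <-> forall i j, dot (v i) (v j) = (1 + w) * (i == j)%:R - w.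
Proof.
split=> [[v1 vw] i j|vw].
  have [<-|ij] := eqVneq i j; first by rewrite v1 mulr1 addrK.
  by rewrite vw // mulr0 sub0r.
split=> [i|i j /negPf ij]; rewrite vw; first by rewrite eqxx mulr1 addrK.
by rewrite ij mulr0 sub0r.
Qed.

Lemma dot_frame_row w v x j : gram_frame w v ->
  dot (x *m frame_mx v) (v j) = (1 + w) * x 0 j - w * \sum_i x 0 i.
Proof.
move=> /gram_frameP vw; rewrite mul_frame_mx dot_suml.
under eq_bigr do rewrite vw mulrBr mulrCA [_ * w]mulrC.
rewrite sumrB -!mulr_sumr; congr (_ * _ - _).
rewrite (bigD1 j) //= eqxx mulr1 big1 ?addr0 // => i /negPf ->.
by rewrite mulr0.
Qed.

(** The Gram matrix is [1 + w] times the identity minus [w] times the all-ones matrix, so the form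
    is invariant under permuting coordinates. *)
Lemma dot_frame w v x y : gram_frame w v ->
  dot (x *m frame_mx v) (y *m frame_mx v) =
  (1 + w) * dot x y - w * ((\sum_i x 0 i) * (\sum_i y 0 i)).
Proof.
move=> vw; rewrite dotC [in LHS](mul_frame_mx y) dot_suml.
under eq_bigr do rewrite dotC (dot_frame_row _ _ vw) mulrBr mulrCA [y 0 _ * x 0 _]mulrC.
by rewrite sumrB -mulr_sumr -mulr_suml mulrCA [_ * \sum_i x _ _]mulrC.
Qed.

(** Pairing a vanishing combination with each [v j] and summing multiplies its coordinate sum by
    [1 - w * (n - 1)], which is positive; then [1 + w] kills each coordinate. *)
Lemma frame_mx_unit w v : -1 < w -> w * (n%:R - 1) < 1 -> gram_frame w v ->
  frame_mx v \in unitmx.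
Proof.
move=> w1 wn vw; rewrite -row_free_unit; apply: inj_row_free => x x0.
have xw j : (1 + w) * x 0 j = w * \sum_i x 0 i.
  apply/eqP; rewrite -subr_eq0 -(dot_frame_row x j vw) x0.
  by rewrite /dot big1 // => i _; rewrite mxE mul0r.
have s0 : \sum_i x 0 i = 0.
  have : (1 + w) * \sum_i x 0 i = w * (\sum_i x 0 i) * n%:R.
    rewrite mulr_sumr (eq_bigr _ (fun j _ => xw j)) sumr_const card_ord.
    by rewrite mulr_natr.
  move/eqP; rewrite -subr_eq0 (_ : _ - _ = (1 - w * (n%:R - 1)) * \sum_i x 0 i).
    by rewrite mulf_eq0 subr_eq0 (gt_eqF wn) => /eqP.
  ring.
apply/rowP => j; rewrite mxE; have /eqP := xw j.
rewrite s0 mulr0 mulf_eq0 => /orP[|/eqP //].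
by rewrite gt_eqF //; lra.
Qed.

Lemma mulmx_affine (M : 'M[R]_n) : affine_fun (mulmxr M : 'rV_n -> 'rV_n).
Proof.
move=> k t p _; rewrite linear_sum; apply: eq_bigr => i _; exact: linearZ.
Qed.

Lemma mulmx_inj (M : 'M[R]_n) : M \in unitmx ->
  injective (mulmxr M : 'rV_n -> 'rV_n).
Proof. by move=> Mu; apply: can_inj (mulmxK Mu). Qed.

Lemma interior_separated_image (M : 'M[R]_n) (A B : set 'rV[R]_n)
    (h : 'rV[R]_n -> R) (d : 'rV[R]_n) b : M \in unitmx ->
  (forall x t, h (x + t *: d) = h x + t) ->
  (forall x, A x -> h x <= b) -> (forall x, B x -> b <= h x) ->
  interior (mulmxr M @` A) `&` interior (mulmxr M @` B) = set0.
Proof.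
move=> Mu hd hA hB.
apply: (@interior_separated _ _ _ _ (fun y => h (y *m invmx M)) (d *m M) b).
- by move=> x t; rewrite mulmxDl -scalemxAl mulmxK.
- by move=> _ [x Ax <-] /=; rewrite mulmxK ?hA.
- by move=> _ [x Bx <-] /=; rewrite mulmxK ?hB.
Qed.

End Frames.

(** * A Gram frame whose tube is parallel to the last axis *)

Section Prism.
Context {R : realType} {m : nat}.
Local Notation n := m.+1.
Context (c l : R) (u : 'I_m -> 'rV[R]_m).

Lemma sum_lift_max (V : zmodType) (F : 'I_n -> V) :
  \sum_i F i = \sum_(i < m) F (lift ord_max i) + F ord_max.
Proof.
rewrite big_ord_recr; congr (_ + _); apply: eq_bigr => i _; congr F.
by apply: val_inj; rewrite [RHS]lift_max.
Qed.

(* Coordinates, in the frame [u], of [n] vectors with sum zero. *)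
Definition simplex_coord (i : 'I_n) : 'rV[R]_m :=
  if unlift ord_max i is Some i' then delta_mx 0 i' else const_mx (-1).

(** All vectors have height [l]; their horizontal parts are [c] times the vectors of [u] and, for
    the last index, [c] times minus their sum. *)
Definition prism_frame (i : 'I_n) : 'rV[R]_n :=
  \row_j if unlift ord_max j is Some j'
         then c * (simplex_coord i *m frame_mx u) 0 j' else l.

Lemma prism_frame_lift i k : prism_frame i 0 (lift ord_max k) =
  c * (simplex_coord i *m frame_mx u) 0 k.
Proof. by rewrite mxE liftK. Qed.

(** The vectors of [u] together with minus their sum are unit vectors with mutual products [-1/m].
    The values of [c] and [l] give [c^2 + l^2 = 1] and [l^2 - c^2/m = -w]. *)
Lemma prism_frame_gram w : (0 < m)%N -> gram_frame (m%:R^-1) u ->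
  c ^+ 2 = m%:R * (w + 1) / n%:R -> l ^+ 2 = (1 - w * m%:R) / n%:R ->
  gram_frame w prism_frame.
Proof.
move=> m0 um c2 l2; apply/gram_frameP => i j.
have mR : m%:R != 0 :> R by rewrite pnatr_eq0 -lt0n.
have nR : n%:R != 0 :> R by rewrite pnatr_eq0.
have -> : dot (prism_frame i) (prism_frame j) =
    c ^+ 2 * dot (simplex_coord i *m frame_mx u) (simplex_coord j *m frame_mx u)
    + l ^+ 2.
  rewrite {1}/dot sum_lift_max; congr (_ + _); last first.
    by rewrite !mxE unlift_none expr2.
  rewrite mulr_sumr; apply: eq_bigr => k _.
  by rewrite !prism_frame_lift mulrACA expr2.
rewrite (dot_frame _ _ um).
have sum_delta k : \sum_i (delta_mx 0 k : 'rV[R]_m) 0 i = 1.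
  rewrite (bigD1 k) //= mxE !eqxx big1 ?addr0 // => k' /negPf kk'.
  by rewrite mxE kk'.
have dot_delta k (y : 'rV[R]_m) : dot (delta_mx 0 k) y = y 0 k.
  rewrite /dot (bigD1 k) //= mxE !eqxx mul1r big1 ?addr0 // => k' /negPf kk'.
  by rewrite mxE kk' mul0r.
have sum_const : \sum_i (const_mx (-1) : 'rV[R]_m) 0 i = - m%:R.
  under eq_bigr do rewrite mxE.
  by rewrite sumr_const card_ord mulNrn.
rewrite c2 l2 /simplex_coord.
have nE : n%:R = m%:R + 1 :> R by rewrite natr1.
rewrite nE in nR *.
case: (unliftP ord_max i) => [i' ->|->]; case: (unliftP ord_max j) => [j' ->|->].
- rewrite !sum_delta dot_delta mxE eqxx (inj_eq lift_inj) /=.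
  by field; apply/andP.
- rewrite sum_delta sum_const dot_delta mxE eq_sym (negPf (neq_lift _ _)) /= mulr0.
  by field; apply/andP.
- rewrite sum_delta sum_const dotC dot_delta mxE (negPf (neq_lift _ _)) /= mulr0.
  by field; apply/andP.
- rewrite sum_const eqxx mulr1.
  have -> : dot (const_mx (-1) : 'rV[R]_m) (const_mx (-1)) = m%:R.
    rewrite /dot; under eq_bigr do rewrite !mxE mulrNN mulr1.
    by rewrite sumr_const card_ord.
  by field; apply/andP.
Qed.

Lemma prism_frame_last (x : 'rV[R]_n) :
  (x *m frame_mx prism_frame) 0 ord_max = l * \sum_i x 0 i.
Proof.
rewrite mxE mulr_sumr; apply: eq_bigr => i _.
by rewrite !mxE unlift_none mulrC.
Qed.

Lemma prism_frame_col' (x : 'rV[R]_n) :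
  col' ord_max (x *m frame_mx prism_frame) =
  c *: ((\row_i (x 0 (lift ord_max i) - x 0 ord_max)) *m frame_mx u).
Proof.
have -> : \row_i (x 0 (lift ord_max i) - x 0 ord_max) =
    \sum_i x 0 i *: simplex_coord i.
  apply/rowP => k; rewrite mxE summxE sum_lift_max /=.
  rewrite !mxE /simplex_coord unlift_none mxE mulrN1 (bigD1 k) //= liftK.
  rewrite !mxE !eqxx mulr1 big1 ?addr0 // => i ik.
  by rewrite !mxE liftK mxE eq_sym (negPf ik) mulr0.
apply/rowP => k; rewrite mul_frame_mx mulmx_suml [RHS]mxE mxE !summxE mulr_sumr.
apply: eq_bigr => i _; rewrite -scalemxAl mxE prism_frame_lift mulrCA.
by rewrite [in RHS]mxE.
Qed.

(** Horizontally only the differences with the last coordinate matter; the tube condition makes them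
    decreasing within [[0, 1]], which is the staircase of [u]. The height is [l] times the
    coordinate sum. *)
Lemma prism_tube : 0 < c -> 0 < l ->
  prism (n := n) (scaled c (staircase u)) l =
  mulmxr (frame_mx prism_frame) @` tube_slab.
Proof.
move=> c0 l0; apply/seteqP; split=> [y [j [jm]]|_ [x [xd xs] <-]]; last first.
  exists ord_max; split=> //=.
    rewrite prism_frame_col'; eexists; last by [].
    rewrite staircaseE; eexists; last by [].
    have /unrolled_decrP[xle x1] := xd.
    split=> [i|i k ik]; rewrite !mxE.
      have := xle ord0 (lift ord_max i) isT.
      have := xle (lift ord_max i) ord_max.
      by rewrite -ltnS ltn_ord => /(_ isT); lra.
    by rewrite lerD2r xle // !lift_max.
  by rewrite prism_frame_last; case/andP: xs; nra.
have -> : j = ord_max by apply: val_inj.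
rewrite staircaseE => -[_ [lam [lam01 lamle] <-] yE] yl.
(* The last coordinate [s] is chosen to make the total [n * s] plus the sum of [lam] equal to the
   height over [l]. *)
pose s := (y 0 ord_max / l - \sum_i lam 0 i) / n%:R.
pose x : 'rV[R]_n := \row_i
  (s + if unlift ord_max i is Some i' then lam 0 i' else 0).
have xl i : x 0 (lift ord_max i) = s + lam 0 i by rewrite mxE liftK.
have xm : x 0 ord_max = s by rewrite mxE unlift_none addr0.
have sx : \sum_i x 0 i = y 0 ord_max / l.
  rewrite sum_lift_max xm (eq_bigr _ (fun i _ => xl i)) big_split /=.
  rewrite sumr_const card_ord -mulr_natr.
  have -> : s * m%:R = y 0 ord_max / l - \sum_i lam 0 i - s.
    have : s * n%:R = y 0 ord_max / l - \sum_i lam 0 i.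
      by rewrite /s divfK // pnatr_eq0.
    by rewrite -natr1 mulrDr mulr1; lra.
  by ring.
exists x; first split.
- apply/unrolled_decrP; split=> [i k|].
    case: (unliftP ord_max i) => [i' ->|->]; case: (unliftP ord_max k) => [k' ->|->] //.
    + by rewrite !lift_max !xl lerD2l; apply: lamle.
    + by rewrite xl xm lerDl; case/andP: (lam01 i').
    + by rewrite lift_max leqNgt ltn_ord.
  rewrite xm; case: (unliftP ord_max (ord0 : 'I_n)) => [i ->|->].
    by rewrite xl; case/andP: (lam01 i); lra.
  by rewrite xm subrr.
- case/andP: yl => y0 yl.
  by rewrite sx ler_pdivrMr // mul1r divr_ge0 // ltW.
apply/rowP => i; case: (unliftP ord_max i) => [k ->|->]; last first.
  by rewrite /= prism_frame_last sx mulrCA divff ?mulr1 // gt_eqF.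
have := congr1 (fun z : 'rV[R]_m => z 0 k) (prism_frame_col' x).
rewrite mxE /= => ->.
have -> : \row_i (x 0 (lift ord_max i) - x 0 ord_max) = lam.
  by apply/rowP => i'; rewrite mxE xl xm addrAC subrr add0r.
by rewrite yE mxE.
Qed.

End Prism.

Theorem theorem2 (R : realType) (n : nat) (w : R)
    (Q : set 'rV[R]_n) (P : set 'rV[R]_n.-1)
    (hn : (2 <= n)%N) (hw1 : -1 < w) (hw2 : w < 1 / (n%:R - 1))
    (hQ : is_Q w Q) (hP : is_P P) :
  let c := Num.sqrt ((n%:R - 1) * (w + 1) / n%:R) in
  let l := Num.sqrt ((1 - w * (n%:R - 1)) / n%:R) in
  equidissectable Q (prism (scaled c P) l).
Proof.
move=> c l.
case: n hn hw2 Q P hQ hP @c @l => [//|m] m0 hw2 Q P [v vw ->] [u um ->].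
have nm : m.+1%:R - 1 = m%:R :> R by rewrite -natr1 addrK.
rewrite nm in hw2 *.
move=> c l; rewrite /= in P u um *.
have mR : 0 < m%:R :> R by rewrite ltr0n.
have nR : 0 < m.+1%:R :> R by rewrite ltr0n.
have wm : w * m%:R < 1 by rewrite -ltr_pdivlMr.
have c2 : 0 < m%:R * (w + 1) / m.+1%:R.
  by rewrite divr_gt0 // mulr_gt0 //; lra.
have l2 : 0 < (1 - w * m%:R) / m.+1%:R by rewrite divr_gt0 // subr_gt0.
have c0 : 0 < c by rewrite sqrtr_gt0.
have l0 : 0 < l by rewrite sqrtr_gt0.
pose V := prism_frame c l u.
have Vw : gram_frame w V.
  by apply: prism_frame_gram um _ _ => //; rewrite sqr_sqrtr // ltW.
have wm' : w * (m.+1%:R - 1) < 1 by rewrite nm.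
have vu := frame_mx_unit hw1 wm' vw; have Vu := frame_mx_unit hw1 wm' Vw.
pose F (k : 'I_m.+1) := mulmxr (frame_mx v) @` stair_slab k.
(* Read coordinates in [v], shift them, and rebuild the point in [V], which has the same Gram
   matrix. *)
pose g (k : 'I_m.+1) y := screw k (y *m invmx (frame_mx v)) *m frame_mx V.
pose G (k : 'I_m.+1) := mulmxr (frame_mx V) @` (screw k @` stair_slab k).
have gF k : g k @` F k = G k.
  apply/seteqP; split=> [_ [_ [x xk <-] <-]|_ [_ [x xk <-] <-]].
    by exists (screw k x); [exists x|rewrite /g /= mulmxK].
  by exists (x *m frame_mx v); [exists x|rewrite /g mulmxK].
have Fpoly k : polytope (F k).
  apply: polytope_image; [exact: mulmx_affine|exact: mulmx_inj|].
  exact: stair_slab_polytope.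
have Gpoly k : polytope (G k).
  apply: polytope_image; [exact: mulmx_affine|exact: mulmx_inj|].
  apply: polytope_image; [exact: screw_affine|exact: screw_inj|].
  exact: stair_slab_polytope.
have QF : staircase v = \bigcup_k F k.
  by rewrite staircaseE stairs_slabs image_bigcup.
have PG : prism (n := m.+1) (scaled c (staircase u)) l = \bigcup_k G k.
  by rewrite prism_tube // tube_slab_screw image_bigcup.
split; [by rewrite QF; apply: polytope_bigcup| |].
  by rewrite PG; apply: polytope_bigcup.
exists m.+1, F, G, g; split=> //.
- split=> // i j; wlog ij : i j / (i < j)%N => [hwlog|_].
    move=> ne; case: (ltngtP i j) => [ij|ji|/val_inj ijE].
    + exact: hwlog.
    + by rewrite setIC; apply: hwlog => //; rewrite eq_sym.
    + by rewrite ijE eqxx in ne.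
  (* The coordinate sum separates the slabs of the simplex; along [d] it grows at unit speed. *)
  apply: (interior_separated_image (h := fun x => dot x (const_mx 1))
    (d := const_mx (m.+1%:R^-1)) (b := j%:R)) => //.
  + move=> x t; rewrite dotDl dotZl; congr (_ + _).
    rewrite dot_ones; under eq_bigr do rewrite mxE.
    by rewrite sumr_const card_ord -[X in _ * X]mulr_natr mulVf ?mulr1 ?gt_eqF.
  + move=> x [_ /andP[_ xi]]; apply: le_trans xi _.
    by rewrite natr1 ler_nat.
  + by move=> x [_ /andP[]].
- split=> // i j; wlog ij : i j / (j < i)%N => [hwlog|_].
    move=> ne; case: (ltngtP j i) => [ij|ji|/val_inj ijE].
    + exact: hwlog.
    + by rewrite setIC; apply: hwlog => //; rewrite eq_sym.
    + by rewrite ijE eqxx in ne.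
  (* Coordinate [m - j] separates the images: after [j] shifts it is [unroll x m], which is
     nonnegative, and after [i > j] shifts its index is at least [n], where values are
     nonpositive. *)
  have mj : (m - j < m.+1)%N by rewrite ltnS leq_subr.
  have jm : (j <= m)%N by rewrite -ltnS.
  apply: (interior_separated_image (h := fun x => x 0 (Ordinal mj))
    (d := delta_mx 0 (Ordinal mj)) (b := 0)) => //.
  + by move=> x t; rewrite !mxE !eqxx mulr1.
  + move=> _ [x [/stairsE[xd _ xn] _] <-]; rewrite mxE /=.
    by apply: le_trans xn; apply: xd; lia.
  + by move=> _ [x [/stairsE[_ xm _] _] <-]; rewrite mxE /= subnK.
move=> k; split=> // x y; rewrite /edist; congr Num.sqrt.
rewrite -mulmxBl (dot_frame _ _ Vw).
rewrite -[x in RHS](mulmxKV vu) -[y in RHS](mulmxKV vu) -mulmxBl (dot_frame _ _ vw).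
have sq := sum_screw_diff k (x *m invmx (frame_mx v)) (y *m invmx (frame_mx v)).
by rewrite /dot (sq (fun t => t * t)) (sq id).
Qed.
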